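(* Let $E$ be a Banach space. The map $\iota\colon\mathrm{FNfA}[E]\to C(B_{E^*})$ extends to an injective lattice-algebra homomorphism $\hat\iota\colon\mathrm{FBfA}[E]\to C(B_{E^*})$ if and only if $\mathrm{FBfA}[E]$ is semiprime.
   Context: All spaces are real. A vector lattice algebra is a real associative algebra that is also a vector lattice in which the product of positive elements is positive. An $f$-algebra is a vector lattice algebra such that $a\wedge b=0$ and $c\ge 0$ imply $(ac)\wedge b=0=(ca)\wedge b$. A normed (resp. Banach) $f$-algebra is an $f$-algebra equipped with a (complete) submultiplicative lattice norm. It is semiprime if $a^2=0$ implies $a=0$. A lattice-algebra homomorphism is a linear map preserving the lattice operations and the product. Contractive means of operator norm at most $1$. The free normed (resp. Banach) $f$-algebra generated by $E$ is a normed (resp. Banach) $f$-algebra $\mathrm{FNfA}[E]$ (resp. $\mathrm{FBfA}[E]$) together with a linear isometric embedding $\eta_E$ of $E$ into it (write $\eta_x=\eta_E(x)$) such that for every normed (resp. Banach) $f$-algebra $A$ and every contractive operator $T\colon E\to A$ there exists a unique lattice-algebra homomorphism $\hat T$ from the free object to $A$ satisfying $\hat T\circ\eta_E=T$ and $\|\hat T\|=\|T\|$. These exist and are unique up to isometric lattice-algebra isomorphism; $\mathrm{FNfA}[E]$ is generated as a vector lattice algebra by $\{\eta_x:x\in E\}$, and $\mathrm{FBfA}[E]$ is the norm completion of $\mathrm{FNfA}[E]$. $B_{E^*}$ is the closed unit ball of $E^*$ with the weak$^*$ topology; $C(B_{E^*})$ has the supremum norm and pointwise order and product. $\iota\colon\mathrm{FNfA}[E]\to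 C(B_{E^*})$ is the unique injective and contractive lattice-algebra homomorphism satisfying $(\iota\eta_x)(x^* )=x^*(x)$ for all $x\in E$, $x^*\in B_{E^*}$. $\hat\iota$ is its extension by continuity to the completion $\mathrm{FBfA}[E]$. *)

(* Defs.v *)
From HB Require Import structures.
From mathcomp Require Import all_boot all_order all_algebra.
From mathcomp Require Import all_classical all_reals all_analysis.

Set Implicit Arguments.
Unset Strict Implicit.
Unset Printing Implicit Defensive.

Import Order.TTheory GRing.Theory Num.Theory.
Import numFieldNormedType.Exports.

Local Open Scope classical_set_scope.
Local Open Scope ring_scope.

Reserved Notation "x <=v y" (at level 70, y at next level).

(* The order is not an Order.Lattice structure: an ordered and normed type    *)
(* built on the library classes would need a join below Num.NumDomain.        *)
HB.mixin Record Lmodule_isVectorLattice (R : realType) V & GRing.Lmodule R V := {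
  vle : rel V ;
  vmeet : V -> V -> V ;
  vjoin : V -> V -> V ;
  vle_refl : reflexive vle ;
  vle_anti : antisymmetric vle ;
  vle_trans : transitive vle ;
  vle_meet : forall x y z, vle z (vmeet x y) = vle z x && vle z y ;
  vle_join : forall x y z, vle (vjoin x y) z = vle x z && vle y z ;
  vle_add2r : forall z x y, vle x y -> vle (x + z) (y + z) ;
  vscale_ge0 : forall (a : R) x, 0 <= a -> vle 0 x -> vle 0 (a *: x)
}.

#[short(type="vectorLatticeType")]
HB.structure Definition VectorLattice (R : realType) :=
  {V of GRing.Lmodule R V & Lmodule_isVectorLattice R V}.

Notation "x <=v y" := (vle x y) : ring_scope.

(* The product is a new operation: the algebra rings of the library are       *)
(* unital, whereas free f-algebras have no unit.                              *)
HB.mixin Record VectorLattice_isAlgebra (R : realType) A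
    & VectorLattice R A := {
  amul : A -> A -> A ;
  amulA : associative amul ;
  amulDl : left_distributive amul +%R ;
  amulDr : right_distributive amul +%R ;
  amulZl : forall (a : R) (x y : A), amul (a *: x) y = a *: amul x y ;
  amulZr : forall (a : R) (x y : A), amul x (a *: y) = a *: amul x y ;
  amul_ge0 : forall x y : A, 0 <=v x -> 0 <=v y -> 0 <=v amul x y
}.

#[short(type="vlAlgType")]
HB.structure Definition VectorLatticeAlgebra (R : realType) :=
  {A of VectorLattice R A & VectorLattice_isAlgebra R A}.

HB.mixin Record VectorLatticeAlgebra_isFAlgebra (R : realType) A
    & VectorLatticeAlgebra R A := {
  amul_meet0 : forall a b c : A, vmeet a b = 0 -> 0 <=v c ->
    vmeet (amul a c) b = 0 /\ vmeet (amul c a) b = 0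
}.

#[short(type="fAlgType")]
HB.structure Definition FAlgebra (R : realType) :=
  {A of VectorLatticeAlgebra R A & VectorLatticeAlgebra_isFAlgebra R A}.

(* The modulus |x| of a vector lattice, not to be confused with the norm.     *)
Definition vlabs (R : realType) (V : vectorLatticeType R) (x : V) : V :=
  vjoin x (- x).

HB.mixin Record FAlgebra_isNormed (R : realType) A
    & FAlgebra R A & NormedModule R A := {
  norm_lattice : forall x y : A, vlabs x <=v vlabs y -> `|x| <= `|y| ;
  norm_amul : forall x y : A, `|amul x y| <= `|x| * `|y|
}.

#[short(type="normedFAlgType")]
HB.structure Definition NormedFAlgebra (R : realType) :=
  {A of FAlgebra R A & NormedModule R A & FAlgebra_isNormed R A}.

#[short(type="banachFAlgType")]
HB.structure Definition BanachFAlgebra (R : realType) :=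
  {A of NormedFAlgebra R A & Complete A}.

Definition semiprime (R : realType) (A : vlAlgType R) : Prop :=
  forall a : A, amul a a = 0 -> a = 0.

Definition lattice_algebra_hom (R : realType) (A B : vlAlgType R)
    (f : {linear A -> B}) : Prop :=
  [/\ forall x y, f (vmeet x y) = vmeet (f x) (f y),
      forall x y, f (vjoin x y) = vjoin (f x) (f y) &
      forall x y, f (amul x y) = amul (f x) (f y)].

(* Extended-real valued, so that it is +oo for unbounded operators.           *)
Definition opnorm (R : realType) (V W : normedModType R) (T : V -> W)
    : \bar R :=
  ereal_sup [set (`|T x|)%:E | x in [set x : V | `|x| <= 1]].

Definition contractive (R : realType) (V W : normedModType R) (T : V -> W)
    : Prop :=
  (opnorm T <= 1)%E.

Definition isometric (R : realType) (V W : normedModType R) (T : V -> W)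
    : Prop :=
  forall x, `|T x| = `|x|.

(* The extension is unique among all extensions, and it has the norm of T.    *)
(* Uniqueness only among extensions of that norm would make every normed      *)
(* f-algebra free over E = 0.                                                 *)
Definition is_free_normed_falg (R : realType) (E : normedModType R)
    (F : normedFAlgType R) (eta : {linear E -> F}) : Prop :=
  isometric eta /\
  forall (A : normedFAlgType R) (T : {linear E -> A}), contractive T ->
  exists That : {linear F -> A},
    [/\ lattice_algebra_hom That,
        forall x, That (eta x) = T x,
        opnorm That = opnorm T &
        forall S : {linear F -> A}, lattice_algebra_hom S ->
          (forall x, S (eta x) = T x) -> S =1 That].

Definition is_free_banach_falg (R : realType) (E : normedModType R)
    (F : banachFAlgType R) (eta : {linear E -> F}) : Prop :=
  isometric eta /\
  forall (A : banachFAlgType R) (T : {linear E -> A}), contractive T ->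
  exists That : {linear F -> A},
    [/\ lattice_algebra_hom That,
        forall x, That (eta x) = T x,
        opnorm That = opnorm T &
        forall S : {linear F -> A}, lattice_algebra_hom S ->
          (forall x, S (eta x) = T x) -> S =1 That].

Definition is_norm_completion (R : realType) (F : normedFAlgType R)
    (G : banachFAlgType R) (j : {linear F -> G}) : Prop :=
  [/\ lattice_algebra_hom j, isometric j & dense (range j)].

HB.mixin Record isCompactSpace K & Topological K := {
  compactT : compact [set: K]
}.

#[short(type="compactSpaceType")]
HB.structure Definition CompactSpace := {K of Topological K & isCompactSpace K}.

Definition cspace (R : realType) (K : topologicalType) : Type :=
  continuousType K R.

HB.instance Definition _ (R : realType) (K : topologicalType) :=
  Choice.on (cspace R K).

Section CSpace.
Variables (R : realType) (K : topologicalType).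
Implicit Types f g h : cspace R K.

Definition mkcspace (f : K -> R) (cf : continuous f) : cspace R K :=
  mkcts cf : continuousType K R.

Lemma mkcspaceE (f : K -> R) (cf : continuous f) x : mkcspace cf x = f x.
Proof. by []. Qed.

Lemma cspaceP f g : (forall x, f x = g x) -> f = g.
Proof. by move=> fg; apply/continuousEP. Qed.

Lemma cspace_cts f : continuous f.
Proof. exact: cts_fun. Qed.

Fact cs0_subproof : continuous (fun _ : K => 0 : R).
Proof. exact: cst_continuous. Qed.
Fact csN_subproof f : continuous (fun x => - f x).
Proof. by move=> x; apply: cvgN; exact: cspace_cts. Qed.
Fact csD_subproof f g : continuous (fun x => f x + g x).
Proof. by move=> x; apply: cvgD; exact: cspace_cts. Qed.
Fact csZ_subproof (a : R) f : continuous (fun x => a * f x).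
Proof. by move=> x; apply: cvgM; [exact: cvg_cst|exact: cspace_cts]. Qed.
Fact csM_subproof f g : continuous (fun x => f x * g x).
Proof. by move=> x; apply: cvgM; exact: cspace_cts. Qed.
Fact csmin_subproof f g : continuous (fun x => Num.min (f x) (g x)).
Proof. by move=> x; apply: continuous_min; exact: cspace_cts. Qed.
Fact csmax_subproof f g : continuous (fun x => Num.max (f x) (g x)).
Proof. by move=> x; apply: continuous_max; exact: cspace_cts. Qed.

Definition cs0 := mkcspace cs0_subproof.
Definition csN f := mkcspace (@csN_subproof f).
Definition csD f g := mkcspace (@csD_subproof f g).
Definition csZ a f := mkcspace (@csZ_subproof a f).
Definition csM f g := mkcspace (@csM_subproof f g).
Definition csmin f g := mkcspace (@csmin_subproof f g).
Definition csmax f g := mkcspace (@csmax_subproof f g).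

Fact csDA : associative csD.
Proof. by move=> f g h; apply: cspaceP => x; exact: addrA. Qed.
Fact csDC : commutative csD.
Proof. by move=> f g; apply: cspaceP => x; exact: addrC. Qed.
Fact cs0D : left_id cs0 csD.
Proof. by move=> f; apply: cspaceP => x; exact: add0r. Qed.
Fact csND : left_inverse cs0 csN csD.
Proof. by move=> f; apply: cspaceP => x; exact: addNr. Qed.

HB.instance Definition _ :=
  GRing.isZmodule.Build (cspace R K) csDA csDC cs0D csND.

Fact csZA a b f : csZ a (csZ b f) = csZ (a * b) f.
Proof. by apply: cspaceP => x; exact: mulrA. Qed.
Fact cs1Z : left_id 1 csZ.
Proof. by move=> f; apply: cspaceP => x; exact: mul1r. Qed.
Fact csZDr : right_distributive csZ +%R.
Proof. by move=> a f g; apply: cspaceP => x; exact: mulrDr. Qed.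
Fact csZDl f : {morph csZ^~ f : a b / a + b}.
Proof. by move=> a b; apply: cspaceP => x; exact: mulrDl. Qed.

HB.instance Definition _ :=
  GRing.Zmodule_isLmodule.Build R (cspace R K) csZA cs1Z csZDr csZDl.

Definition csle f g : bool := `[< forall x, f x <= g x >].

Fact csle_refl : reflexive csle.
Proof. by move=> f; apply/asboolP => x. Qed.
Fact csle_anti : antisymmetric csle.
Proof.
move=> f g /andP[/asboolP fg /asboolP gf].
by apply: cspaceP => x; apply/le_anti; rewrite fg gf.
Qed.
Fact csle_trans : transitive csle.
Proof.
move=> g f h /asboolP fg /asboolP gh.
by apply/asboolP => x; exact: le_trans (fg x) (gh x).
Qed.
Fact csle_min f g h : csle h (csmin f g) = csle h f && csle h g.
Proof.
apply/asboolP/andP => [H|[/asboolP H1 /asboolP H2] x].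
  by split; apply/asboolP => x; have := H x; rewrite le_min => /andP[].
by rewrite le_min H1 H2.
Qed.
Fact csle_max f g h : csle (csmax f g) h = csle f h && csle g h.
Proof.
apply/asboolP/andP => [H|[/asboolP H1 /asboolP H2] x].
  by split; apply/asboolP => x; have := H x; rewrite ge_max => /andP[].
by rewrite ge_max H1 H2.
Qed.
Fact csle_add2r h f g : csle f g -> csle (f + h) (g + h).
Proof. by move=> /asboolP fg; apply/asboolP => x; exact: lerD. Qed.
Fact csZ_ge0 (a : R) f : 0 <= a -> csle 0 f -> csle 0 (a *: f).
Proof.
by move=> a0 /asboolP f0; apply/asboolP => x; exact: mulr_ge0 a0 (f0 x).
Qed.

HB.instance Definition _ := Lmodule_isVectorLattice.Build R (cspace R K)
  csle_refl csle_anti csle_trans csle_min csle_max csle_add2r csZ_ge0.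

Lemma cspace_leP f g : reflect (forall x, f x <= g x) (f <=v g).
Proof. exact: asboolP. Qed.

Fact csMA : associative csM.
Proof. by move=> f g h; apply: cspaceP => x; exact: mulrA. Qed.
Fact csMDl : left_distributive csM +%R.
Proof. by move=> f g h; apply: cspaceP => x; exact: mulrDl. Qed.
Fact csMDr : right_distributive csM +%R.
Proof. by move=> f g h; apply: cspaceP => x; exact: mulrDr. Qed.
Fact csMZl (a : R) f g : csM (a *: f) g = a *: csM f g.
Proof. by apply: cspaceP => x; symmetry; exact: mulrA. Qed.
Fact csMZr (a : R) f g : csM f (a *: g) = a *: csM f g.
Proof. by apply: cspaceP => x; exact: mulrCA. Qed.
Fact csM_ge0 f g : 0 <=v f -> 0 <=v g -> 0 <=v csM f g.
Proof.
move=> /cspace_leP f0 /cspace_leP g0.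
by apply/cspace_leP => x; exact: mulr_ge0 (f0 x) (g0 x).
Qed.

HB.instance Definition _ := VectorLattice_isAlgebra.Build R (cspace R K)
  csMA csMDl csMDr csMZl csMZr csM_ge0.

Lemma cspace0E x : (0 : cspace R K) x = 0. Proof. by []. Qed.
Lemma cspaceNE f x : (- f) x = - f x. Proof. by []. Qed.
Lemma cspaceDE f g x : (f + g) x = f x + g x. Proof. by []. Qed.
Lemma cspaceZE (a : R) f x : (a *: f) x = a * f x. Proof. by []. Qed.
Lemma cspaceME f g x : (amul f g) x = f x * g x. Proof. by []. Qed.
Lemma cspace_meetE f g x : (vmeet f g) x = Num.min (f x) (g x).
Proof. by []. Qed.
Lemma cspace_joinE f g x : (vjoin f g) x = Num.max (f x) (g x).
Proof. by []. Qed.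
Lemma cspace_vlabsE f x : vlabs f x = `|f x|.
Proof. by rewrite cspace_joinE cspaceNE maxrN. Qed.

Fact csM_meet0 f g h : vmeet f g = 0 -> 0 <=v h ->
  vmeet (amul f h) g = 0 /\ vmeet (amul h f) g = 0.
Proof.
move=> fg0 /cspace_leP h0.
have E x : Num.min (f x * h x) (g x) = 0.
  have := congr1 (fun k : cspace R K => k x) fg0.
  rewrite cspace_meetE cspace0E; have := h0 x; rewrite cspace0E => hx.
  case: (leP (f x) (g x)) => [fg f0|gf g0].
    by rewrite f0 mul0r min_l// -f0.
  by rewrite g0 min_r// mulr_ge0// ltW// -g0.
by split; apply: cspaceP => x; rewrite cspace_meetE cspaceME ?(mulrC (h x)) E.
Qed.

HB.instance Definition _ :=
  VectorLatticeAlgebra_isFAlgebra.Build R (cspace R K) csM_meet0.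

End CSpace.

Section CSpaceNorm.
Variables (R : realType) (K : compactSpaceType).
Implicit Types f g : cspace R K.

Definition csnorm f : R := sup (range (fun x => `|f x|)).

Lemma csnorm_has_ubound f : has_ubound (range (fun x => `|f x|)).
Proof.
have : compact (range f : set R^o).
  apply: continuous_compact compactT.
  by apply: continuous_subspaceT; exact: cspace_cts.
move=> /compact_bounded[M [_ MP]].
exists (M + 1) => _ [x _ <-].
by apply: (MP (M + 1)); [rewrite ltrDl|exists x].
Qed.

Lemma csnorm_ub f x : `|f x| <= csnorm f.
Proof. by apply: ub_le_sup; [exact: csnorm_has_ubound|exists x]. Qed.

Lemma csnorm_le f (M : R) : 0 <= M -> (forall x, `|f x| <= M) -> csnorm f <= M.
Proof.
move=> M0 fM; rewrite /csnorm.
have [->|/set0P ne] := eqVneq (range (fun x => `|f x|)) set0.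
  by rewrite sup0.
by apply: ge_sup => // _ [x _ <-].
Qed.

Lemma csnorm_ge0 f : 0 <= csnorm f.
Proof.
have [e|/set0P[_ [x _ _]]] := eqVneq (range (fun x => `|f x|)) set0.
  by rewrite /csnorm e sup0.
exact: le_trans (normr_ge0 (f x)) (csnorm_ub f x).
Qed.

Fact csnormD f g : csnorm (f + g) <= csnorm f + csnorm g.
Proof.
apply: csnorm_le => [|x]; first by rewrite addr_ge0 ?csnorm_ge0.
by rewrite cspaceDE (le_trans (ler_normD _ _))// lerD ?csnorm_ub.
Qed.

Fact csnormZ (a : R) f : csnorm (a *: f) = `|a| * csnorm f.
Proof.
apply/eqP; rewrite eq_le; apply/andP; split.
  apply: csnorm_le => [|x]; first by rewrite mulr_ge0 ?csnorm_ge0.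
  by rewrite cspaceZE normrM ler_wpM2l ?csnorm_ub.
have [->|a0] := eqVneq a 0; first by rewrite normr0 mul0r csnorm_ge0.
rewrite -ler_pdivlMl ?normr_gt0//.
apply: csnorm_le => [|x]; first by rewrite mulr_ge0 ?invr_ge0 ?csnorm_ge0.
by rewrite ler_pdivlMl ?normr_gt0// -normrM -cspaceZE csnorm_ub.
Qed.

Fact csnorm_eq0 f : csnorm f = 0 -> f = 0.
Proof.
move=> f0; apply: cspaceP => x; apply/eqP.
by rewrite cspace0E -normr_le0 -f0 csnorm_ub.
Qed.

HB.instance Definition _ :=
  Lmodule_isNormed.Build R (cspace R K) csnormD csnormZ csnorm_eq0.

Lemma cspace_normE f : `|f| = sup (range (fun x => `|f x|)).
Proof. by []. Qed.

Fact csnorm_lattice f g : vlabs f <=v vlabs g -> `|f| <= `|g|.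
Proof.
move=> /cspace_leP fg; apply: csnorm_le => [|x]; first exact: csnorm_ge0.
by have := fg x; rewrite !cspace_vlabsE => /le_trans; apply; exact: csnorm_ub.
Qed.

Fact csnorm_amul f g : `|amul f g| <= `|f| * `|g|.
Proof.
apply: csnorm_le => [|x]; first by rewrite mulr_ge0 ?csnorm_ge0.
by rewrite cspaceME normrM ler_pM ?csnorm_ub.
Qed.

HB.instance Definition _ :=
  FAlgebra_isNormed.Build R (cspace R K) csnorm_lattice csnorm_amul.

End CSpaceNorm.

Section DualBall.
Variables (R : realType) (E : normedModType R).

Record dual_ball : Type := DualBall {
  dual_fun :> {linear E -> R^o} ;
  dual_continuous : continuous dual_fun ;
  dual_opnorm : (opnorm dual_fun <= 1)%E
}.

HB.instance Definition _ := gen_eqMixin dual_ball.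
HB.instance Definition _ := gen_choiceMixin dual_ball.

(* The weak* topology is the topology of pointwise convergence on E.          *)
Definition weakstar_ball : Type :=
  initial_topology (fun (u : dual_ball) => (u : E -> R) : {ptws E -> R}).

HB.instance Definition _ := Topological.on weakstar_ball.

Lemma dual_ball_le (u : dual_ball) x : `|u x| <= `|x|.
Proof.
have [->|x0] := eqVneq x 0; first by rewrite linear0 normr0.
have nx0 : 0 < `|x| by rewrite normr_gt0.
have : (`|u (`|x|^-1 *: x)|%:E <= 1)%E.
  apply: le_trans (dual_opnorm u); apply: ereal_sup_ubound.
  exists (`|x|^-1 *: x) => //=.
  by rewrite normrZ ger0_norm ?invr_ge0// mulVf ?gt_eqF.
rewrite lee_fin linearZ normrZ ger0_norm ?invr_ge0//.
by rewrite ler_pdivrMl// mulr1.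
Qed.

Section MkDualBall.
Variables (p : E -> R^o) (plin : linear p) (pb : forall x, `|p x| <= `|x|).

Let p' : {linear E -> R^o} :=
  HB.pack p (GRing.isLinear.Build R E R^o _ p plin).

Fact mkdual_continuous : continuous p'.
Proof.
apply: bounded_linear_continuous; apply/linear_boundedP.
exists 1; split => // r r1 x; apply: le_trans (pb x) _.
by rewrite ler_peMl// ltW.
Qed.

Fact mkdual_opnorm : (opnorm p' <= 1)%E.
Proof.
by apply: ge_ereal_sup => _ [x /= x1 <-]; rewrite lee_fin (le_trans (pb x)).
Qed.

Definition mkdual_ball : dual_ball :=
  @DualBall p' mkdual_continuous mkdual_opnorm.

Lemma mkdual_ballE x : mkdual_ball x = p x. Proof. by []. Qed.

End MkDualBall.

(* Banach-Alaoglu *)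
Lemma weakstar_ball_compact : compact [set: weakstar_ball].
Proof.
pose phi (u : weakstar_ball) : {ptws E -> R} := (u : dual_ball) : E -> R.
have cprod : @compact {ptws E -> R}
    [set g | forall x, (`[- `|x|, `|x|]%classic : set R) (g x)].
  by apply: (@tychonoff E (fun=> R) (fun x => `[- `|x|, `|x|]%classic)) => x;
    exact: segment_compact.
move=> F FF _.
have [|p [pb pcl]] := cprod (phi @ F) _.
  suff : F [set u : weakstar_ball |
    forall x, (`[- `|x|, `|x|]%classic : set R) (phi u x)] by [].
  apply: filterE => u x /=.
  by rewrite in_itv /= -ler_norml; exact: (dual_ball_le (u : dual_ball) x).
have projC (x : E) : continuous (fun g : {ptws E -> R} => g x).
  exact: (@proj_continuous E (fun=> R) x).
have plin : linear (p : E -> R^o).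
  move=> a x y.
  pose h (g : {ptws E -> R}) : R^o := g (a *: x + y) - (a * g x + g y).
  have hC : continuous h.
    move=> g.
    have cst_a : (fun _ : {ptws E -> R} => a : R^o) @ nbhs g --> (a : R^o).
      exact: cvg_cst.
    exact: (@cvgB _ R^o _ _ _ _ _ _ _ (projC (a *: x + y) g)
      (@cvgD _ R^o _ _ _ _ _ _ _ (cvgM cst_a (projC x g)) (projC y g))).
  have hcl : closed (h @^-1` [set 0]).
    by apply: preimage_closed => //; exact: closed_eq.
  suff : h p = 0 by move/eqP; rewrite subr_eq0 => /eqP.
  apply: hcl => B pB; apply: pcl pB.
  suff : F [set u : weakstar_ball | h (phi u) = 0] by [].
  apply: filterE => u; apply/eqP; rewrite subr_eq0; apply/eqP.
  exact: (linearP (dual_fun u)).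
have pb' x : `|(p : E -> R^o) x| <= `|x|.
  by have := pb x; rewrite /= in_itv /= -ler_norml.
exists (mkdual_ball plin pb' : weakstar_ball); split=> // A B FA.
move=> [_ [[C Co <-] Cp] CB].
have [_ [[u Au <-] Cu]] : (phi @` A) `&` C !=set0.
  apply: pcl; last exact: open_nbhs_nbhs.
  suff : F [set u | (phi @` A) (phi u)] by [].
  by apply: filterS FA => u Au; exists u.
by exists u; split => //; exact: CB.
Qed.

HB.instance Definition _ := isCompactSpace.Build weakstar_ball
  weakstar_ball_compact.

End DualBall.

Definition is_iota (R : realType) (E : normedModType R) (F : normedFAlgType R)
    (eta : {linear E -> F})
    (iota : {linear F -> cspace R (weakstar_ball E)}) : Prop :=
  [/\ lattice_algebra_hom iota,
      injective iota,
      contractive iota &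
      forall (x : E) (u : weakstar_ball E), iota (eta x) u = (u : dual_ball E) x].

(* Main.v *)
Require Import Defs.
From HB Require Import structures.
From mathcomp Require Import all_boot all_order all_algebra.
From mathcomp Require Import all_classical all_reals all_analysis.
From mathcomp Require Import ring lra.

(** Function algebras are semiprime, so an injective extension makes the free
Banach f-algebra semiprime.  Conversely, the universal property applied to the
evaluation map of [E] into the Banach f-algebra of continuous functions on the
dual ball gives the extension at once, and only its injectivity needs an
argument.  It rests on two facts.

- In a semiprime Banach f-algebra the modulus of a nonzero element has a
  positive value at some contractive real character, that is, at some linear
  map to the reals that preserves meets and products ([exists_character]).

- Every contractive real character of the free Banach f-algebra is evaluation
  at a point of the dual ball, namely its restriction to [E], because a
  lattice-algebra homomorphism on the free object is determined by its values
  on the generators ([character_eval]).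

For the first fact, the submultiplicative norm dominates the product also in
order: [amul a x <=v l *: x] for positive [a], [x] and [l > `|a|]
([amul_le]).  Take [a = vlabs f] for a nonzero [f]; then [amul a a] is nonzero
by semiprimeness, so it is not below [e *: a] for some [e > 0].  A prime ideal
that avoids the positive part of [amul a a - e *: a] gives a total order on a
quotient of the vector lattice, in which every [amul b a] lies between two
multiples of [a].  Its standard part relative to [a] is a real number [phi b],
and [phi] is the required character: right multiplication by [a] is a lattice
homomorphism, and [amul_le] makes left multiplication by [b] act on standard
parts as multiplication by [phi b]. *)

Set Implicit Arguments.
Unset Strict Implicit.
Unset Printing Implicit Defensive.

Import Order.TTheory GRing.Theory Num.Theory.
Import numFieldNormedType.Exports.

Local Open Scope classical_set_scope.
Local Open Scope ring_scope.

(** * Order and disjointness in vector lattices *)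

Section VectorLattices.
Context {R : realType} {V : vectorLatticeType R}.
Implicit Types x y z t : V.

Lemma vle_subr x y : (x <=v y) = (0 <=v y - x).
Proof.
apply/idP/idP => [/(vle_add2r (- x))|/(vle_add2r x)]; first by rewrite subrr.
by rewrite add0r subrK.
Qed.

Lemma vleD x y z t : x <=v y -> z <=v t -> x + z <=v y + t.
Proof.
move=> /(vle_add2r z) xy /(vle_add2r y).
by rewrite ![_ + y]addrC; exact: vle_trans.
Qed.

Lemma vleN2 x y : (- x <=v - y) = (y <=v x).
Proof. by rewrite vle_subr opprK addrC -vle_subr. Qed.

Lemma vle_subl_addr x y z : (x - y <=v z) = (x <=v z + y).
Proof. by rewrite vle_subr [RHS]vle_subr opprB addrA. Qed.

Lemma vleZ (a : R) x y : 0 <= a -> x <=v y -> a *: x <=v a *: y.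
Proof.
rewrite [x <=v y]vle_subr [_ *: x <=v _]vle_subr -scalerBr.
exact: vscale_ge0.
Qed.

Lemma vleZl (a b : R) x : a <= b -> 0 <=v x -> a *: x <=v b *: x.
Proof.
by move=> ab x0; rewrite vle_subr -scalerBl vscale_ge0// subr_ge0.
Qed.

Lemma vle_eq x y : x <=v y -> y <=v x -> x = y.
Proof. by move=> xy yx; apply: (@vle_anti R V); rewrite xy yx. Qed.

Lemma vmeet_lel x y : vmeet x y <=v x.
Proof. by have := vle_refl (vmeet x y); rewrite vle_meet => /andP[]. Qed.

Lemma vmeet_ler x y : vmeet x y <=v y.
Proof. by have := vle_refl (vmeet x y); rewrite vle_meet => /andP[]. Qed.

Lemma vjoin_gel x y : x <=v vjoin x y.
Proof. by have := vle_refl (vjoin x y); rewrite vle_join => /andP[]. Qed.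

Lemma vjoin_ger x y : y <=v vjoin x y.
Proof. by have := vle_refl (vjoin x y); rewrite vle_join => /andP[]. Qed.

Lemma vmeetC x y : vmeet x y = vmeet y x.
Proof. by apply: vle_eq; rewrite vle_meet vmeet_lel vmeet_ler. Qed.

Lemma vjoinC x y : vjoin x y = vjoin y x.
Proof. by apply: vle_eq; rewrite vle_join vjoin_gel vjoin_ger. Qed.

Lemma vmeetDr x y z : vmeet (x + z) (y + z) = vmeet x y + z.
Proof.
apply: vle_eq; last by rewrite vle_meet !vle_add2r ?vmeet_lel ?vmeet_ler.
by rewrite -vle_subl_addr vle_meet !vle_subl_addr vmeet_lel vmeet_ler.
Qed.

Lemma vjoin_oppr x y : vjoin x y = - vmeet (- x) (- y).
Proof.
apply: vle_eq.
  rewrite vle_join; apply/andP.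
  by split; rewrite -vleN2 opprK ?vmeet_lel ?vmeet_ler.
rewrite -[vjoin _ _]opprK vleN2 vle_meet !vleN2.
by rewrite vjoin_gel vjoin_ger.
Qed.

Lemma vjoinDr x y z : vjoin (x + z) (y + z) = vjoin x y + z.
Proof. by rewrite !vjoin_oppr !opprD vmeetDr opprD opprK. Qed.

Definition vpos x : V := vjoin x 0.

Lemma vpos_ge0 x : 0 <=v vpos x. Proof. exact: vjoin_ger. Qed.
Lemma vpos_ge x : x <=v vpos x. Proof. exact: vjoin_gel. Qed.

Lemma vpos_le x y : x <=v y -> 0 <=v y -> vpos x <=v y.
Proof. by move=> xy y0; rewrite vle_join xy. Qed.

Lemma vpos_id x : 0 <=v x -> vpos x = x.
Proof. by move=> x0; apply: vle_eq (vpos_ge x); rewrite vpos_le ?vle_refl. Qed.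

Lemma vpos_eq0 x : vpos x = 0 -> x <=v 0.
Proof. by move=> <-; exact: vpos_ge. Qed.

Lemma vposN x : vpos (- x) = - vmeet x 0.
Proof. by rewrite /vpos vjoin_oppr opprK oppr0. Qed.

Lemma vposBN x : vpos x - vpos (- x) = x.
Proof.
by apply/eqP; rewrite subr_eq addrC -vjoinDr addNr add0r vjoinC.
Qed.

Lemma vmeet0_ge0 x y : vmeet x y = 0 -> 0 <=v x /\ 0 <=v y.
Proof. by move=> <-; rewrite vmeet_lel vmeet_ler. Qed.

Lemma vmeet0P x y : 0 <=v x -> 0 <=v y ->
  (forall w, w <=v x -> w <=v y -> w <=v 0) -> vmeet x y = 0.
Proof.
move=> x0 y0 H; apply: vle_eq; last by rewrite vle_meet x0.
by apply: H; [exact: vmeet_lel|exact: vmeet_ler].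
Qed.

Lemma vmeet0_le x y w : vmeet x y = 0 -> w <=v x -> w <=v y -> w <=v 0.
Proof. by move=> <- wx wy; rewrite vle_meet wx. Qed.

Lemma vpos_disjoint x : vmeet (vpos x) (vpos (- x)) = 0.
Proof.
rewrite -[X in vmeet X _](subrK (vpos (- x))) vposBN.
by rewrite -[X in vmeet _ X]add0r vmeetDr vposN subrr.
Qed.

Lemma disjoint_le x y z : 0 <=v z -> z <=v x -> vmeet x y = 0 -> vmeet z y = 0.
Proof.
move=> z0 zx xy; have [_ y0] := vmeet0_ge0 xy.
apply: vmeet0P => // w wz wy.
by apply: vmeet0_le xy _ wy; exact: vle_trans wz zx.
Qed.

Lemma disjointD x y z : vmeet x z = 0 -> vmeet y z = 0 -> vmeet (x + y) z = 0.
Proof.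
move=> xz yz; have [x0 z0] := vmeet0_ge0 xz; have [y0 _] := vmeet0_ge0 yz.
apply: vmeet0P => // [|w wxy wz]; first by rewrite -[0]addr0 vleD.
apply: (vmeet0_le yz _ wz).
rewrite -[y]add0r -vle_subl_addr; apply: vmeet0_le xz _ _.
  by rewrite vle_subl_addr.
apply: vle_trans wz; rewrite vle_subl_addr.
by rewrite -[w in w <=v _]addr0 vleD ?vle_refl.
Qed.

Lemma disjointMn x y n : vmeet x y = 0 -> vmeet (x *+ n) y = 0.
Proof.
move=> xy; elim: n => [|n IHn]; last by rewrite mulrS disjointD.
have [_ y0] := vmeet0_ge0 xy.
by rewrite mulr0n; apply: vle_eq (vmeet_lel _ _) _; rewrite vle_meet vle_refl.
Qed.

Lemma vlabs_ge x : x <=v vlabs x. Proof. exact: vjoin_gel. Qed.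
Lemma vlabs_geN x : - x <=v vlabs x. Proof. exact: vjoin_ger. Qed.

Lemma vlabs_pos x : 0 <=v x -> vlabs x = x.
Proof.
move=> x0; apply: vle_eq (vlabs_ge x); rewrite vle_join vle_refl/=.
by apply: (@vle_trans _ _ 0) => //; rewrite -oppr0 vleN2.
Qed.

Lemma vlabs_ge0 x : 0 <=v vlabs x.
Proof.
have := vleD (vlabs_ge x) (vlabs_geN x); rewrite subrr => h.
have half0 : 0 <= 2^-1 :> R by rewrite invr_ge0 ler0n.
have := vscale_ge0 _ _ half0 h.
by rewrite scalerDr -scalerDl -[2^-1]mul1r -splitr scale1r.
Qed.

End VectorLattices.

(** * Prime ideals and total cones *)

Section Ideals.
Context {R : realType} {V : vectorLatticeType R}.
Implicit Types x y z v : V.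

Definition positive_ideal (P : set V) : Prop :=
  [/\ forall x, P x -> 0 <=v x,
      forall x y, P x -> P y -> P (x + y) &
      forall x y, 0 <=v x -> x <=v y -> P y -> P x].

(** An ideal that is maximal among those avoiding [v] is prime: if [x] and [y]
are disjoint and both outside [P], then [v] is bounded, modulo [P], by a
multiple of [x] and by a multiple of [y], hence by the meet of these multiples,
which vanishes. *)
Lemma exists_prime_ideal v : 0 <=v v -> v <> 0 ->
  exists P : set V, [/\ positive_ideal P, ~ P v &
    forall x y, vmeet x y = 0 -> P x \/ P y].
Proof.
move=> v0 vn0.
have [|P [[[P0 PD Ple] Pv] Pmax]] :=
    @Zorn_bigcup V [set P | positive_ideal P /\ ~ P v].
  move=> F FP Ftot; split; last by move=> [X FX Xv]; have [] := FP _ FX.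
  split.
  - by move=> x [X /FP[[X0 _ _] _] /X0].
  - move=> x y [X FX Xx] [Y FY Yy].
    have [[_ XD _] _] := FP _ FX; have [[_ YD _] _] := FP _ FY.
    have [/(_ _ Xx) Yx|/(_ _ Yy) Xy] := Ftot _ _ FX FY.
      by exists Y => //; exact: YD.
    by exists X => //; exact: XD.
  - move=> x y x0 xy [X FX Xy]; exists X => //.
    by have [[_ _ Xle] _] := FP _ FX; exact: Xle Xy.
exists P; split=> // x y xy.
have [x0 y0] := vmeet0_ge0 xy.
have [Px|nPx] := pselect (P x); first by left.
have [Py|nPy] := pselect (P y); first by right.
exfalso.
(* The empty set is a positive ideal, so 0 has to be adjoined by hand. *)
pose P0' := P `|` [set 0].
have P0'D p q : P0' p -> P0' q -> P0' (p + q).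
  move=> [Pp|->]; last by rewrite add0r.
  by move=> [Pq|->]; [left; exact: PD|rewrite addr0; left].
have bound z : 0 <=v z -> ~ P z -> exists p n, P0' p /\ v <=v p + z *+ n.
  move=> z0 nPz.
  pose B := [set b | 0 <=v b /\ exists p n, P0' p /\ b <=v p + z *+ n].
  have Bid : positive_ideal B.
    split.
    - by move=> b [].
    - move=> b c [b0 [p [n [Pp bp]]]] [c0 [q [m [Pq cq]]]].
      split; first by rewrite -[0]addr0 vleD.
      exists (p + q), (n + m)%N; split; first exact: P0'D.
      by rewrite mulrnDr addrACA vleD.
    - move=> b c b0 bc [c0 [q [m [Pq cq]]]]; split=> //.
      by exists q, m; split=> //; exact: vle_trans bc cq.
  have PB : P `<` B.
    split; last first.
      move=> /(_ z) BP; apply/nPz/BP; split=> //.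
      by exists 0, 1%N; rewrite add0r mulr1n vle_refl; split=> //; right.
    move=> p Pp; split; first exact: P0.
    by exists p, 0%N; rewrite mulr0n addr0 vle_refl; split=> //; left.
  by apply: contrapT => nB; apply: (Pmax _ PB); split=> // -[_].
have [p [n [Pp vp]]] := bound x x0 nPx.
have [q [m [Pq vq]]] := bound y y0 nPy.
have Ppq := P0'D _ _ Pp Pq.
have P0'0 r : P0' r -> 0 <=v r by case=> [/P0//|->]; rewrite vle_refl.
have xyk : vmeet (x *+ n) (y *+ m) = 0.
  by rewrite disjointMn// vmeetC disjointMn// vmeetC.
have vpq : v <=v p + q.
  rewrite -[p + q]add0r -vle_subl_addr.
  apply: vmeet0_le xyk _ _; rewrite vle_subl_addr.
    apply: vle_trans vp _.
    by rewrite addrC vleD ?vle_refl// -[p in p <=v _]addr0 vleD ?vle_refl ?P0'0.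
  apply: vle_trans vq _.
  by rewrite addrC vleD ?vle_refl// -[q in q <=v _]add0r vleD ?vle_refl ?P0'0.
case: Ppq => [Ppq|pq0]; first by apply: Pv; exact: Ple vpq Ppq.
by apply: vn0; apply: vle_eq => //; rewrite -pq0.
Qed.

(** Such a [C] is the preimage of the positive cone under a lattice
homomorphism onto a totally ordered vector lattice.  The form of [cone_dom]
covers monotonicity and scaling, and also makes [C] stable under positive
operators dominated by a multiple of the identity. *)
Record total_cone (C : set V) : Prop := TotalCone {
  coneD : forall x y, C x -> C y -> C (x + y) ;
  cone_dom : forall (a : R) x y, 0 <= a -> C x ->
    - (a *: vpos (- x)) <=v y -> C y ;
  cone_total : forall x, C x \/ C (- x) ;
  cone_meet : forall x y, C x -> C y -> C (vmeet x y)
}.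

Lemma exists_total_cone v : 0 <=v v -> v <> 0 ->
  exists2 C : set V, total_cone C & ~ C (- v).
Proof.
move=> v0 vn0; have [P [[P0 PD Ple] Pv Pprime]] := exists_prime_ideal v0 vn0.
exists [set x | P (vpos (- x))] => /=; last by rewrite opprK vpos_id.
have PMn p n : P p -> P (p *+ n.+1).
  by move=> Pp; elim: n => [//|n IHn]; rewrite mulrS; exact: PD.
have PZ (a : R) p : 0 <= a -> P p -> P (a *: p).
  move=> a0 Pp; have p0 := P0 _ Pp.
  apply: Ple (vscale_ge0 _ _ a0 p0) _ (PMn p (Num.trunc a) Pp).
  by rewrite -scaler_nat vleZl// ltW// truncnS_gt.
split=> /=.
- move=> x y Px Py; apply: Ple (vpos_ge0 _) _ (PD _ _ Px Py).
  by rewrite vpos_le ?opprD ?vleD ?vpos_ge// -[0]addr0 vleD ?vpos_ge0.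
- move=> a x y a0 Px xy; apply: Ple (vpos_ge0 _) _ (PZ _ _ a0 Px).
  by rewrite vpos_le ?vscale_ge0 ?vpos_ge0// -vleN2 opprK.
- by move=> x; rewrite opprK orC; apply: Pprime; exact: vpos_disjoint.
- move=> x y Px Py; apply: Ple (vpos_ge0 _) _ (PD _ _ Px Py).
  rewrite vpos_le//; last by rewrite -[0]addr0 vleD ?vpos_ge0.
  have -> : - vmeet x y = vjoin (- x) (- y) by rewrite vjoin_oppr !opprK.
  rewrite vle_join -[- x]addr0 -[- y]add0r.
  by rewrite !vleD ?vpos_ge ?vpos_ge0//; rewrite ?addr0 ?add0r ?vpos_ge.
Qed.

Section ConeTheory.
Variable C : set V.
Hypothesis CC : total_cone C.

Lemma cone_ge0 x : 0 <=v x -> C x.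
Proof.
move=> x0; have C0 : C 0 by have [|] := cone_total CC 0; rewrite ?oppr0.
by apply: (cone_dom CC (a := 0)) C0 _ => //; rewrite scale0r oppr0.
Qed.

Lemma cone_le x y : C x -> x <=v y -> C y.
Proof.
move=> Cx xy; have Cyx : C (y - x) by apply: cone_ge0; rewrite -vle_subr.
by have := coneD CC Cx Cyx; rewrite addrC subrK.
Qed.

Lemma coneZ (a : R) x : 0 <= a -> C x -> C (a *: x).
Proof.
move=> a0 Cx; apply: (cone_dom CC a0 Cx).
by rewrite -scalerN vleZ// -[x in _ <=v x]opprK vleN2 vpos_ge.
Qed.

End ConeTheory.

End Ideals.

(** * Domination of the product by the norm *)

Section NormedFAlgebras.
Context {R : realType} {A : normedFAlgType R}.
Implicit Types a b c x y : A.

Lemma amulNl x y : amul (- x) y = - amul x y :> A.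
Proof. by rewrite -scaleN1r amulZl scaleN1r. Qed.

Lemma amulNr x y : amul x (- y) = - amul x y :> A.
Proof. by rewrite -[- y]scaleN1r amulZr scaleN1r. Qed.

Lemma amul_ler a x y : 0 <=v a -> x <=v y -> amul a x <=v amul a y.
Proof.
move=> a0; rewrite vle_subr => xy; rewrite vle_subr -amulNr -amulDr.
exact: amul_ge0.
Qed.

Lemma amul_lel a x y : 0 <=v a -> x <=v y -> amul x a <=v amul y a.
Proof.
move=> a0; rewrite vle_subr => xy; rewrite vle_subr -amulNl -amulDl.
exact: amul_ge0.
Qed.

Lemma ler_norm_vle x y : 0 <=v x -> x <=v y -> `|x| <= `|y|.
Proof.
move=> x0 xy; apply: norm_lattice; rewrite !vlabs_pos//.
exact: vle_trans xy.
Qed.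

Lemma norm_vlabs x : `|vlabs x| = `|x|.
Proof.
apply/le_anti/andP; split; apply: norm_lattice.
  by rewrite (vlabs_pos (vlabs_ge0 x)) vle_refl.
by rewrite (vlabs_pos (vlabs_ge0 x)) vle_refl.
Qed.

(** Let [y] be the positive part of [amul a x - x].  In a totally ordered
quotient where [y] is nonzero, [amul a] expands [x], so all iterates [p n] of
[amul a] at [x] stay above [x]; in the f-algebra itself this reads as the
disjointness [qy].  Hence the meet of [x] and [y] is below every [p n].  As the
norms of the [p n] tend to 0 this meet is 0, and so is [y], being below
[amul a x]. *)
Lemma amul_le_of_norm_lt1 a x : `|a| < 1 -> 0 <=v a -> 0 <=v x ->
  amul a x <=v x.
Proof.
move=> a1 a0 x0; set y := vpos (amul a x - x).
pose p n := iter n (amul a) x.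
have p0 n : 0 <=v p n by elim: n => [//|n IHn]; exact: amul_ge0.
have pn n : `|p n| <= `|x| * `|a| ^+ n.
  elim: n => [|n IHn]; first by rewrite mulr1.
  by rewrite exprS mulrCA (le_trans (norm_amul _ _))// ler_wpM2l.
have qy n : vmeet (vpos (x - p n)) y = 0.
  elim: n => [|n IHn].
    by rewrite subrr vpos_id ?vle_refl// vmeet0P ?vle_refl ?vpos_ge0.
  have [_ aq] := amul_meet0 _ _ a IHn a0.
  have xaxy : vmeet (vpos (x - amul a x)) y = 0.
    by rewrite vmeetC -[x - _]opprB vpos_disjoint.
  apply: disjoint_le (vpos_ge0 _) _ (disjointD xaxy aq).
  apply: vpos_le; last first.
    by rewrite -[0]addr0 vleD ?vpos_ge0 ?amul_ge0 ?vpos_ge0.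
  rewrite (_ : x - p n.+1 = (x - amul a x) + amul a (x - p n)).
    by rewrite vleD ?vpos_ge// amul_ler ?vpos_ge.
  by rewrite amulDr amulNr addrA subrK.
have wp n : vmeet x y <=v p n.
  rewrite -[p n]add0r -vle_subl_addr; apply: (vmeet0_le (qy n)).
    by apply: vle_trans (vpos_ge _); rewrite vle_add2r// vmeet_lel.
  rewrite vle_subl_addr; apply: vle_trans (vmeet_ler x y) _.
  by rewrite -[y in y <=v _]addr0 vleD ?vle_refl.
have w0 : 0 <=v vmeet x y by rewrite vle_meet x0 vpos_ge0.
have xy0 : vmeet x y = 0.
  apply/eqP; rewrite -normr_le0.
  have g0 : geometric `|x| `|a| @ \oo --> (0 : R).
    by apply: cvg_geometric; rewrite normr_id.
  apply: (cvgr_to_ge g0); near=> n; rewrite /=.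
  exact: le_trans (ler_norm_vle w0 (wp n)) (pn n).
have yax : y <=v amul a x.
  apply: vpos_le; last exact: amul_ge0.
  by rewrite vle_subl_addr -[amul a x in X in X <=v _]addr0 vleD ?vle_refl.
have [_ axy] := amul_meet0 _ _ a xy0 a0.
have y0 : y = 0.
  apply: vle_eq (vpos_ge0 _); rewrite -axy vle_meet yax.
  exact: vle_refl.
by have := vpos_eq0 y0; rewrite vle_subl_addr add0r.
Unshelve. all: by end_near. Qed.

Lemma amul_le a x (l : R) : `|a| < l -> 0 <=v a -> 0 <=v x ->
  amul a x <=v l *: x.
Proof.
move=> al a0 x0; have l0 : 0 < l by exact: le_lt_trans al.
have := @amul_le_of_norm_lt1 (l^-1 *: a) x.
rewrite normrZ gtr0_norm ?invr_gt0// mulrC ltr_pdivrMr// mul1r => /(_ al).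
rewrite vscale_ge0 ?invr_ge0 ?(ltW l0)// => /(_ isT x0) /(vleZ (ltW l0)).
by rewrite amulZl scalerA divff ?scale1r// gt_eqF.
Qed.

End NormedFAlgebras.

(** * Standard parts *)

Section StandardPart.
Context {R : realType} {V : vectorLatticeType R}.
Variables (C : set V) (u : V).
Hypotheses (CC : total_cone C) (u0 : 0 <=v u) (Cu : ~ C (- u)).
Implicit Types (x y : V) (s t : R).

(** In the total order given by [C], [x] lies within [e *: u] of [s *: u] for
every real [e > 0]. *)
Definition standard_part x s : Prop :=
  forall e, 0 < e -> C (x - (s - e) *: u) /\ C ((s + e) *: u - x).

Lemma cone_unit_ge0 t : C (t *: u) -> 0 <= t.
Proof.
move=> Ct; rewrite leNgt; apply/negP => t0; apply: Cu.
have nt0 : 0 <= - t^-1 by rewrite oppr_ge0 invr_le0 ltW.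
have := coneZ CC nt0 Ct.
by rewrite scalerA mulNr mulVf ?lt_eqF// scaleN1r.
Qed.

Lemma standard_part_ge x s t :
  standard_part x s -> C (x - t *: u) -> t <= s.
Proof.
move=> xs Ct; apply/ler_addgt0Pr => e e0; have [_ Cs] := xs e e0.
have := coneD CC Cs Ct; rewrite addrA subrK -scalerBl => /cone_unit_ge0.
by rewrite subr_ge0.
Qed.

Lemma standard_part_uniq x s t :
  standard_part x s -> standard_part x t -> s = t.
Proof.
move=> xs xt; apply/le_anti/andP; split; apply/ler_addgt0Pr => e e0.
  by rewrite -lerBlDr; apply: standard_part_ge xt _; have [] := xs e e0.
by rewrite -lerBlDr; apply: standard_part_ge xs _; have [] := xt e e0.
Qed.

Lemma standard_partN x s : standard_part x s -> standard_part (- x) (- s).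
Proof.
move=> xs e e0; have [C1 C2] := xs e e0; split.
  by rewrite -[- s - e]opprD scaleNr opprK addrC.
by rewrite opprK addrC [- s + e]addrC -[e - s]opprB scaleNr.
Qed.

Lemma standard_partD x y s t :
  standard_part x s -> standard_part y t -> standard_part (x + y) (s + t).
Proof.
move=> xs yt e e0; have e2 : 0 < e / 2 by rewrite divr_gt0.
have [C1 C2] := xs _ e2; have [C3 C4] := yt _ e2; split.
  have -> : s + t - e = (s - e / 2) + (t - e / 2).
    by rewrite {1}(splitr e); ring.
  by rewrite scalerDl opprD addrACA; exact: coneD.
have -> : s + t + e = (s + e / 2) + (t + e / 2).
  by rewrite {1}(splitr e); ring.
by rewrite scalerDl opprD addrACA; exact: coneD.
Qed.

Lemma standard_partZ (a : R) x s :
  standard_part x s -> standard_part (a *: x) (a * s).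
Proof.
have pos b : 0 < b -> standard_part x s -> standard_part (b *: x) (b * s).
  move=> b0 xs e e0; have [|C1 C2] := xs (e / b); first by rewrite divr_gt0.
  have := coneZ CC (ltW b0) C1; have := coneZ CC (ltW b0) C2.
  rewrite !scalerBr !scalerA mulrDr mulrBr.
  by rewrite (mulrC b (e / b)) divfK ?gt_eqF.
move=> xs; have [a0|a0|->] := ltgtP a 0.
- have := pos (- a); rewrite oppr_gt0 => /(_ a0 xs) /standard_partN.
  by rewrite scaleNr mulNr !opprK.
- exact: pos.
- move=> e e0; rewrite scale0r mul0r; split.
    rewrite sub0r sub0r scaleNr opprK.
    by apply: cone_ge0 => //; exact: vscale_ge0 (ltW e0) u0.
  rewrite add0r subr0.
  by apply: cone_ge0 => //; exact: vscale_ge0 (ltW e0) u0.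
Qed.

Lemma standard_part_meet x y s t : standard_part x s -> standard_part y t ->
  standard_part (vmeet x y) (Num.min s t).
Proof.
wlog st : x y s t / s <= t.
  move=> H xs yt; have [st|/ltW ts] := leP s t.
    by have := H _ _ _ _ st xs yt; rewrite (min_idPl st).
  by have := H _ _ _ _ ts yt xs; rewrite (min_idPl ts) vmeetC.
move=> xs yt e e0; rewrite (min_idPl st).
have [C1 C2] := xs e e0; have [C3 _] := yt e e0; split.
  rewrite -vmeetDr; apply: cone_meet => //.
  apply: cone_le C3 _ => //.
  by rewrite ![y + _]addrC vle_add2r// vleN2 vleZl// lerB.
apply: cone_le C2 _ => //.
by rewrite ![(s + e) *: u - _]addrC vle_add2r// vleN2 vmeet_lel.
Qed.

(** Bounded elements have a standard part: the cut of the real line into the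
multiples of [u] below and above [x]. *)
Lemma standard_part_exists x l : x <=v l *: u -> - (l *: u) <=v x ->
  exists s, standard_part x s.
Proof.
move=> xl lx; pose S := [set t | C (x - t *: u)].
have Sl : S (- l).
  rewrite /S/= scaleNr opprK; apply: cone_ge0 => //.
  by rewrite -vle_subl_addr sub0r.
have Sub t : S t -> t <= l.
  move=> St; rewrite -subr_ge0; apply: cone_unit_ge0.
  by rewrite scalerBl; apply: cone_le St _ => //; rewrite vle_add2r.
have hS : has_sup S by split; [exists (- l)|exists l].
exists (sup S) => e e0; split.
  have [t St lt] := sup_adherent e0 hS.
  apply: cone_le St _ => //.
  by rewrite ![x + _]addrC vle_add2r// vleN2 vleZl// ltW.
have [Se|] := cone_total CC (x - (sup S + e) *: u); last by rewrite opprB.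
by have := sup_upper_bound hS Se; rewrite leNgt ltrDl e0.
Qed.

End StandardPart.

(** * Real characters of f-algebras *)

Section Characters.
Context {R : realType} {A : normedFAlgType R}.
Implicit Types a b c x y : A.

(** The elements [b - d] and [c - d] are disjoint for the meet [d] of [b] and
[c], and the f-algebra axiom keeps them disjoint after multiplication. *)
Lemma amul_meetl x b c : 0 <=v x ->
  amul (vmeet b c) x = vmeet (amul b x) (amul c x).
Proof.
move=> x0; set d := vmeet b c.
have bcd : vmeet (b - d) (c - d) = 0 by rewrite vmeetDr subrr.
have [bx _] := amul_meet0 _ _ x bcd x0.
have [cx _] := amul_meet0 _ _ x (etrans (vmeetC _ _) bx) x0.
move: cx; rewrite vmeetC !amulDl !amulNl vmeetDr => /eqP.
by rewrite subr_eq0 => /eqP.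
Qed.

Section ConeCharacter.
Variables (C : set A) (u : A).
Hypotheses (CC : total_cone C) (u0 : 0 <=v u) (Cu : ~ C (- u)).

Local Notation sp := (standard_part C u).

Let norm_lt (b : A) : `|b| < `|b| + 1. Proof. by rewrite ltrDl. Qed.
Let norm1_ge0 (b : A) : 0 <= `|b| + 1. Proof. by rewrite addr_ge0. Qed.

Lemma cone_amul b x : 0 <=v b -> C x -> C (amul b x).
Proof.
move=> b0 Cx; apply: (cone_dom CC (norm1_ge0 b) Cx).
rewrite -[x in amul b x]vposBN amulDr amulNr -[- _]add0r.
rewrite vleD ?amul_ge0 ?vpos_ge0// vleN2.
by rewrite amul_le ?vpos_ge0.
Qed.

Lemma amul_unit_le b (l : R) : `|b| < l ->
  amul b u <=v l *: u /\ - (l *: u) <=v amul b u.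
Proof.
move=> bl; have h : amul (vlabs b) u <=v l *: u.
  by rewrite amul_le ?vlabs_ge0// norm_vlabs.
split; first by apply: vle_trans h; rewrite amul_lel// vlabs_ge.
rewrite -vleN2 opprK -amulNl.
by apply: vle_trans h; rewrite amul_lel// vlabs_geN.
Qed.

(** Multiplication by [b] preserves infinitesimals, since it is dominated by a
multiple of the identity. *)
Lemma standard_part_amul0 b x : 0 <=v b -> sp x 0 -> sp (amul b x) 0.
Proof.
move=> b0 x0 e e0; pose l := `|b| + 1.
have l0 : 0 < l by rewrite ltr_wpDl.
have bu : (e / l) *: amul b u <=v e *: u.
  have := vleZ (ltW (divr_gt0 e0 l0)) (amul_le (norm_lt b) b0 u0).
  by rewrite scalerA divfK ?gt_eqF.
have [] := x0 (e / l) (divr_gt0 e0 l0).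
rewrite !sub0r !add0r !scaleNr !opprK => C1 C2; split.
  have := cone_amul b0 C1; rewrite amulDr amulZr => /cone_le; apply => //.
  by rewrite vleD ?vle_refl.
have := cone_amul b0 C2; rewrite amulDr amulZr amulNr => /cone_le; apply => //.
by rewrite vleD ?vle_refl.
Qed.

(** As [x - s *: u] is infinitesimal, [amul b x] agrees with
[s *: amul b u] up to an infinitesimal. *)
Lemma standard_part_amul_ge0 b x s t : 0 <=v b ->
  sp x s -> sp (amul b u) t -> sp (amul b x) (t * s).
Proof.
move=> b0 xs bt.
have u1 : sp u 1.
  move=> e e0; have Ce : C (e *: u).
    by apply: cone_ge0 => //; exact: vscale_ge0 (ltW e0) u0.
  split; first by rewrite scalerBl scale1r opprB addrC subrK.
  by rewrite scalerDl scale1r addrAC subrr add0r.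
have d0 : sp (x - s *: u) 0.
  have := standard_partD CC xs (standard_partZ CC u0 (- s) u1).
  by rewrite mulr1 subrr scaleNr.
have := standard_partD CC (standard_part_amul0 b0 d0)
  (standard_partZ CC u0 s bt).
by rewrite amulDr amulNr amulZr subrK add0r mulrC.
Qed.

Lemma standard_part_unit b : exists s, sp (amul b u) s.
Proof.
have [h1 h2] := amul_unit_le (norm_lt b).
exact: standard_part_exists h1 h2.
Qed.

Lemma standard_part_amul b x s t :
  sp x s -> sp (amul b u) t -> sp (amul b x) (t * s).
Proof.
move=> xs bt.
have [t1 bt1] := standard_part_unit (vpos b).
have [t2 bt2] := standard_part_unit (vpos (- b)).
have -> : t = t1 - t2.
  apply: standard_part_uniq bt _ => //.
  rewrite -[b]vposBN amulDl amulNl.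
  by apply: standard_partD => //; exact: standard_partN.
rewrite -{1}[b]vposBN amulDl amulNl mulrDl mulNr.
apply: standard_partD; rewrite //.
  exact: standard_part_amul_ge0 (vpos_ge0 _) xs bt1.
apply: standard_partN.
exact: standard_part_amul_ge0 (vpos_ge0 _) xs bt2.
Qed.

End ConeCharacter.

Record character (phi : A -> R^o) : Prop := Character {
  char_linear : linear phi ;
  char_meet : forall b c, phi (vmeet b c) = Num.min (phi b) (phi c) ;
  char_amul : forall b c, phi (amul b c) = phi b * phi c ;
  char_norm : forall b, `|phi b| <= `|b|
}.

(** The standard part of [amul b a] relative to [a] is multiplicative in [b].
As [C] omits the opposite of the positive part [v] of [amul a a - e *: a], it
contains [amul a a - e *: a] itself, whence [e <= phi a]; it also omits [- a],
because [v] is below a multiple of [a]. *)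
Lemma exists_character a : 0 <=v a -> amul a a <> 0 ->
  exists2 phi : A -> R^o, character phi & 0 < phi a.
Proof.
move=> a0 aa0.
have [e e0 ve] : exists2 e : R, 0 < e & vpos (amul a a - e *: a) <> 0.
  apply: contrapT => /forall2NP H; apply/aa0/eqP; rewrite -normr_le0.
  apply/ler_addgt0Pr => e e0; rewrite add0r.
  have n0 : 0 < `|a| + 1 by rewrite ltr_wpDl.
  have [|/contrapT/vpos_eq0] := H (e / (`|a| + 1)); first by rewrite divr_gt0.
  rewrite vle_subl_addr add0r => /ler_norm_vle.
  rewrite amul_ge0// => /(_ isT)/le_trans; apply.
  rewrite normrZ gtr0_norm ?divr_gt0// mulrAC ler_pdivrMr// ler_wpM2l ?ltW//.
  by rewrite ltrDl.
have [C CC Cv] := exists_total_cone (vpos_ge0 _) ve.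
set v := vpos _ in ve Cv.
have Ca : ~ C (- a).
  have n0 : 0 <= `|a| + 1 by rewrite addr_ge0.
  move=> /(coneZ CC n0) => C1; apply: Cv; apply: cone_le C1 _ => //.
  rewrite scalerN vleN2 vpos_le ?vscale_ge0//.
  rewrite vle_subl_addr -[amul a a]addr0 vleD ?vscale_ge0 ?(ltW e0)//.
  by rewrite amul_le// ltrDl.
have Cae : C (amul a a - e *: a).
  have [//|C1] := cone_total CC (amul a a - e *: a).
  case: Cv; rewrite /v -[X in vpos X]opprK vposN opprK.
  exact: cone_meet CC _ _ C1 (cone_ge0 CC (vle_refl 0)).
have [phi phiP] := choice (standard_part_unit CC a0 Ca).
have phiE b s : standard_part C a (amul b a) s -> phi b = s.
  by move=> bs; exact: standard_part_uniq CC Ca _ _ _ (phiP b) bs.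
have phiN b : phi (- b) = - phi b.
  by apply: phiE; rewrite amulNl; exact: standard_partN.
exists phi; last first.
  exact: lt_le_trans e0 (standard_part_ge CC Ca (phiP a) Cae).
split.
- move=> r b c; apply: phiE; rewrite amulDl amulZl.
  by apply: standard_partD => //; exact: standard_partZ.
- by move=> b c; apply: phiE; rewrite amul_meetl//; exact: standard_part_meet.
- by move=> b c; apply: phiE; rewrite -amulA; exact: standard_part_amul.
- have le b : phi b <= `|b|.
    apply/ler_addgt0Pr => d d0; rewrite -lerN2 -phiN.
    apply: (standard_part_ge CC Ca (phiP (- b))).
    apply: cone_ge0 => //; rewrite scaleNr opprK amulNl addrC -vle_subr.
    by have [] := @amul_unit_le _ a0 b (`|b| + d); rewrite ?ltrDl.
  by move=> b; rewrite ler_norml lerNl -phiN le andbT -normrN le.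
Qed.

End Characters.

(** * Completeness of spaces of continuous functions *)

Section CSpaceComplete.
Context {R : realType} {K : compactSpaceType}.

(** A uniform limit of continuous functions is continuous; the limit is taken
in the complete space of all functions with the uniform structure. *)
Fact cspace_complete (F : set_system (cspace R K)) :
  ProperFilter F -> cauchy F -> cvg F.
Proof.
move=> PF /cauchy_ballP Fc.
pose ev (f : cspace R K) : arrow_uniform_type K R := f.
have Gc : cauchy (ev @ F).
  apply/cauchy_ballP => e e0; rewrite near_map2.
  apply: filterS (Fc e e0) => -[f g] /=; rewrite -!ball_normE /= => fg x.
  rewrite -ball_normE /=; apply: le_lt_trans fg.
  exact: (csnorm_ub (f - g) x).
have [g /cvg_fct_entourageP Fg] := iffLR (cvg_ex (ev @ F)) (fun_complete Gc).
have Fge e : 0 < e -> F [set f : cspace R K | forall x, `|g x - f x| < e].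
  move=> e0.
  have : F [set f : cspace R K | forall x, ball (g x) e (f x : R)].
    exact: Fg _ (entourage_ball _ (PosNum e0)).
  by apply: filterS => f /= fg x; have := fg x; rewrite -ball_normE.
have cg : continuous (g : K -> R).
  move=> x; apply/cvgrPdist_lt => e e0.
  have e3 : 0 < e / 3 by rewrite divr_gt0.
  have [f fg] := filter_ex (Fge _ e3).
  have /cvgrPdist_lt/(_ _ e3) := @cspace_cts _ _ f x.
  apply: filterS => y fxy.
  have := fg x; have := fg y; move: fxy.
  rewrite !ltr_distl => /andP[? ?] /andP[? ?] /andP[? ?].
  by apply/andP; split; lra.
apply/cvg_ex; exists (mkcspace cg); apply/cvgrPdist_le => e e0.
apply: filterS (Fge e e0) => f fg.
by apply: csnorm_le (ltW e0) _ => x; exact/ltW/fg.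
Qed.

HB.instance Definition _ :=
  Uniform_isComplete.Build (cspace R K) cspace_complete.

End CSpaceComplete.

(** * Homomorphisms into function algebras *)

Section ConstantFunctions.
Context {R : realType} {A : normedFAlgType R} {K : topologicalType}.
Variables (phi : A -> R^o) (phiP : character phi).

(** For compact [K], this turns a character into a homomorphism with values in a
Banach f-algebra, so that a universal property stated for such algebras
applies to characters. *)
Definition constant_hom_fun (b : A) : cspace R K :=
  mkcspace (@cst_continuous K R (phi b)).

Fact constant_hom_linear : linear constant_hom_fun.
Proof. by move=> r b c; apply: cspaceP => x; exact: (char_linear phiP). Qed.

HB.instance Definition _ := GRing.isLinear.Build R A (cspace R K) _
  constant_hom_fun constant_hom_linear.

Definition constant_hom : {linear A -> cspace R K} := constant_hom_fun.

Lemma constant_homE b x : constant_hom b x = phi b. Proof. by []. Qed.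

Lemma constant_hom_latalg : lattice_algebra_hom constant_hom.
Proof.
split=> b c; apply: cspaceP => x.
- exact: (char_meet phiP).
- rewrite cspace_joinE !constant_homE vjoin_oppr.
  have phiN d : phi (- d) = - phi d.
    have := char_linear phiP (-1) d 0.
    have := char_linear phiP (-1) 0 0.
    rewrite scaler0 addr0 scaleN1r => phi0.
    have {}phi0 : phi 0 = 0 by move: phi0; rewrite addNr.
    by rewrite addr0 phi0 addr0 !scaleN1r.
  by rewrite phiN (char_meet phiP) !phiN oppr_min !opprK.
- exact: (char_amul phiP).
Qed.

End ConstantFunctions.

Lemma lattice_algebra_hom_vlabs (R : realType) (A B : vlAlgType R)
    (f : {linear A -> B}) x :
  lattice_algebra_hom f -> f (vlabs x) = vlabs (f x).
Proof. by move=> [_ fj _]; rewrite /vlabs fj linearN. Qed.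

Lemma lattice_algebra_hom_comp (R : realType) (A B D : vlAlgType R)
    (f : {linear A -> B}) (g : {linear B -> D}) :
  lattice_algebra_hom f -> lattice_algebra_hom g ->
  lattice_algebra_hom (g \o f : {linear A -> D}).
Proof.
move=> [f1 f2 f3] [g1 g2 g3].
by split=> x y /=; rewrite ?f1 ?f2 ?f3 ?g1 ?g2 ?g3.
Qed.

Lemma cspace_semiprime (R : realType) (K : topologicalType) :
  semiprime (cspace R K).
Proof.
move=> f ff; apply: cspaceP => x; apply/eqP.
have := congr1 (fun h : cspace R K => h x) ff.
by rewrite cspaceME cspace0E => /eqP; rewrite mulf_eq0 orbb.
Qed.

Lemma contractive_le (R : realType) (V W : normedModType R)
    (T : {linear V -> W}) :
  (forall x, `|T x| <= `|x|) -> contractive T.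
Proof.
move=> Tle; apply: ge_ereal_sup => _ [x /= x1 <-].
by rewrite lee_fin (le_trans (Tle x)).
Qed.

Lemma le_contractive (R : realType) (V W : normedModType R)
    (T : {linear V -> W}) x :
  contractive T -> `|T x| <= `|x|.
Proof.
move=> T1; have [->|x0] := eqVneq x 0; first by rewrite linear0 !normr0.
have nx0 : 0 < `|x| by rewrite normr_gt0.
have : (`|T (`|x|^-1 *: x)|%:E <= 1)%E.
  apply: le_trans T1; apply: ereal_sup_ubound.
  exists (`|x|^-1 *: x) => //=.
  by rewrite normrZ ger0_norm ?invr_ge0// mulVf ?gt_eqF.
rewrite lee_fin linearZ normrZ ger0_norm ?invr_ge0//.
by rewrite ler_pdivrMl// mulr1.
Qed.

Lemma contractive_continuous (R : realType) (V W : normedModType R)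
    (T : {linear V -> W}) : contractive T -> continuous T.
Proof.
move=> T1; apply: bounded_linear_continuous; apply/linear_boundedP.
exists 1; split => // r r1 x; apply: le_trans (le_contractive x T1) _.
by rewrite ler_peMl// ltW.
Qed.

(** The point [u] is the restriction of [phi] to the generators; evaluation of
[h] at [u] is another character with the same values there, so the two agree by
the uniqueness part of the universal property. *)
Lemma character_eval (R : realType) (E : normedModType R)
    (B : banachFAlgType R) (eta : {linear E -> B})
    (freeB : is_free_banach_falg eta)
    (h : {linear B -> cspace R (weakstar_ball E)})
    (hP : lattice_algebra_hom h) (h1 : contractive h)
    (h_eta : forall x (u : weakstar_ball E), h (eta x) u = (u : dual_ball E) x)
    (phi : B -> R^o) (phiP : character phi) :
  exists u : weakstar_ball E, forall b, phi b = h b u.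
Proof.
have [eta_iso eta_univ] := freeB.
have plin : linear (phi \o eta : E -> R^o).
  by move=> r x y /=; rewrite linearP (char_linear phiP).
have pb x : `|(phi \o eta : E -> R^o) x| <= `|x|.
  by rewrite -eta_iso; exact: (char_norm phiP).
pose u : weakstar_ball E := mkdual_ball plin pb.
have evP : character (fun b => h b u : R^o).
  have [hmeet _ hmul] := hP; split.
  - by move=> r b c; rewrite linearP.
  - by move=> b c; rewrite hmeet.
  - by move=> b c; rewrite hmul.
  - move=> b; apply: le_trans (le_contractive b h1).
    exact: (csnorm_ub (h b) u).
exists u => b.
pose T := constant_hom (K := weakstar_ball E) phiP \o eta
  : {linear E -> cspace R (weakstar_ball E)}.
have T1 : contractive T.
  by apply: contractive_le => x; apply: csnorm_le => // v; exact: pb.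
have [That [_ _ _ uniq]] := eta_univ _ T T1.
have e1 : constant_hom phiP =1 That.
  by apply: uniq => //; exact: constant_hom_latalg.
have e2 : constant_hom evP =1 That.
  apply: uniq => [|x]; first exact: constant_hom_latalg.
  by apply: cspaceP => v; exact: h_eta x u.
by rewrite -(constant_homE phiP b u) e1 -e2.
Qed.

(** * Semiprimeness and injectivity *)

Theorem theorem5p1 (R : realType) (E : completeNormedModType R)
    (FNfA : normedFAlgType R) (etaN : {linear E -> FNfA})
    (FBfA : banachFAlgType R) (etaB : {linear E -> FBfA})
    (j : {linear FNfA -> FBfA})
    (iota : {linear FNfA -> cspace R (weakstar_ball E)})
    (freeN : is_free_normed_falg etaN)
    (freeB : is_free_banach_falg etaB)
    (complj : is_norm_completion j)
    (j_eta : forall x : E, j (etaN x) = etaB x)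
    (iotaP : is_iota etaN iota) :
  (exists ihat : {linear FBfA -> cspace R (weakstar_ball E)},
     [/\ lattice_algebra_hom ihat,
         injective ihat,
         continuous ihat &
         forall f : FNfA, ihat (j f) = iota f])
  <-> semiprime FBfA.
Proof.
have [iota_hom _ _ iota_eta] := iotaP.
split.
  move=> [ihat [[_ _ ihatM] ihat_inj _ _]] a aa0.
  apply: ihat_inj; rewrite linear0; apply: cspace_semiprime.
  by rewrite -ihatM aa0 linear0.
move=> sp; pose T := iota \o etaN : {linear E -> cspace R (weakstar_ball E)}.
have T1 : contractive T.
  apply: contractive_le => x; apply: csnorm_le => // u.
  by rewrite iota_eta; exact: dual_ball_le.
have [_ univB] := freeB; have [_ univN] := freeN.
have [ihat [ihat_hom ihat_eta ihat_norm _]] := univB _ T T1.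
have ihat1 : contractive ihat by rewrite /contractive ihat_norm.
have [j_hom _ _] := complj.
exists ihat; split => //; [|exact: contractive_continuous|].
- have ker0 f : ihat f = 0 -> f = 0.
    move=> f0; apply: contrapT => fn0.
    have aa0 : amul (vlabs f) (vlabs f) <> 0.
      move=> /sp/(congr1 (fun x => `|x|)); rewrite norm_vlabs normr0.
      by move=> /eqP; rewrite normr_eq0 => /eqP.
    have [phi phiP phi0] := exists_character (vlabs_ge0 f) aa0.
    have [|u phiu] := character_eval freeB ihat_hom ihat1 _ phiP.
      by move=> x u; rewrite ihat_eta iota_eta.
    move: phi0; rewrite phiu (lattice_algebra_hom_vlabs _ ihat_hom) f0.
    by rewrite cspace_vlabsE cspace0E normr0 ltxx.
  by move=> f g fg; apply/subr0_eq/ker0; rewrite linearB fg subrr.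
- have [That [_ _ _ uniqN]] := univN _ T T1.
  have e1 : iota =1 That by exact: uniqN.
  have e2 : (ihat \o j : {linear _ -> _}) =1 That.
    apply: uniqN => [|x]; first exact: lattice_algebra_hom_comp.
    by rewrite /= j_eta ihat_eta.
  by move=> f; rewrite e1 -e2.
Qed.
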